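(* Every typed term of the simply typed symmetric $\lambda\mu$-calculus is strongly normalizing for the $\beta\mu\mu'$-reduction, i.e. there is no infinite sequence of $\beta\mu\mu'$-reduction steps starting from it.
   Context: Terms of the symmetric $\lambda\mu$-calculus are given by $\mathcal{T} ::= x \mid \lambda x\,\mathcal{T}\mid(\mathcal{T}\;\mathcal{T})\mid\mu\alpha\,\mathcal{T}\mid(\alpha\;\mathcal{T})$, where $x,y,\dots$ are $\lambda$-variables and $\alpha,\beta,\dots$ are $\mu$-variables; $\lambda x$ and $\mu\alpha$ are binders, terms are considered up to renaming of bound variables and all substitutions are capture-avoiding. Types are built from atomic formulas and the constant $\bot$ with the connective $\rightarrow$; $\neg A$ abbreviates $A\rightarrow\bot$. A context $\Gamma$ is a set of declarations $x:A$ and $\alpha:\neg A$. Typing rules: - $\Gamma,x:A\vdash x:A$; - from $\Gamma,x:A\vdash M:B$ infer $\Gamma\vdash\lambda x\,M:A\rightarrow B$; - from $\Gamma\vdash M:A\rightarrow B$ and $\Gamma\vdash N:A$ infer $\Gamma\vdash(M\;N):B$; - from $\Gamma,\alpha:\neg A\vdash M:\bot$ infer $\Gamma\vdash\mu\alpha\,M:A$; - from $\Gamma,\alpha:\neg A\vdash M:A$ infer $\Gamma,\alpha:\neg A\vdash(\alpha\;M):\bot$. A term is typed if $\Gamma\vdash M:A$ is derivable for some $\Gamma,A$. $M[\alpha=_rN]$ (resp. $M[\alpha=_lN]$) is obtained from $M$ by replacing (recursively) each sub-term of the form $(\alpha\;U)$ by $(\alpha\;(U\;N))$ (resp. $(\alpha\;(N\;U))$).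 The $\beta\mu\mu'$-reduction is the closure under all term constructors of: $(\lambda x\,M\;N)\triangleright_\beta M[x:=N]$; $(\mu\alpha\,M\;N)\triangleright_\mu\mu\alpha\,M[\alpha=_rN]$; $(N\;\mu\alpha\,M)\triangleright_{\mu'}\mu\alpha\,M[\alpha=_lN]$. *)

(* Defs.v *)
From Stdlib Require Import Arith List.
Import ListNotations.

Set Implicit Arguments.

(** Terms up to renaming of bound variables are de Bruijn terms with two
    independent index spaces: [Lam] binds index 0 of the lambda-variables and
    [Mu] binds index 0 of the mu-variables. *)
Inductive term : Type :=
| Var (x : nat)
| Lam (M : term)
| App (M N : term)
| Mu (M : term)
| Name (a : nat) (M : term).

Definition up_ren (r : nat -> nat) (n : nat) : nat :=
  match n with 0 => 0 | S m => S (r m) end.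

(** [rl] acts on the free lambda-variables, [rm] on the free mu-variables. *)
Fixpoint rename (rl rm : nat -> nat) (M : term) : term :=
  match M with
  | Var x => Var (rl x)
  | Lam M => Lam (rename (up_ren rl) rm M)
  | App M N => App (rename rl rm M) (rename rl rm N)
  | Mu M => Mu (rename rl (up_ren rm) M)
  | Name a M => Name (rm a) (rename rl rm M)
  end.

Definition shift_lam : term -> term := rename S (fun a => a).
Definition shift_mu : term -> term := rename (fun x => x) S.

Definition scons (N : term) (s : nat -> term) (n : nat) : term :=
  match n with 0 => N | S m => s m end.

(** Capture-avoiding parallel substitution for the lambda-variables. *)
Fixpoint subst (s : nat -> term) (M : term) : term :=
  match M with
  | Var x => s x
  | Lam M => Lam (subst (scons (Var 0) (fun n => shift_lam (s n))) M)
  | App M N => App (subst s M) (subst s N)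
  | Mu M => Mu (subst (fun n => shift_mu (s n)) M)
  | Name a M => Name a (subst s M)
  end.

(** [M[x := N]] where [x] is the lambda-variable of index 0, which disappears. *)
Definition subst0 (N M : term) : term := subst (scons N Var) M.

(** [mu_subst_r a N M] is [M[a =_r N]] and [mu_subst_l a N M] is [M[a =_l N]].
    The mu-variable [a] remains in the result, so no index is lowered. *)
Fixpoint mu_subst_r (a : nat) (N M : term) : term :=
  match M with
  | Var x => Var x
  | Lam M => Lam (mu_subst_r a (shift_lam N) M)
  | App M1 M2 => App (mu_subst_r a N M1) (mu_subst_r a N M2)
  | Mu M => Mu (mu_subst_r (S a) (shift_mu N) M)
  | Name b U =>
      let U' := mu_subst_r a N U in
      Name b (if Nat.eqb b a then App U' N else U')
  end.

Fixpoint mu_subst_l (a : nat) (N M : term) : term :=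
  match M with
  | Var x => Var x
  | Lam M => Lam (mu_subst_l a (shift_lam N) M)
  | App M1 M2 => App (mu_subst_l a N M1) (mu_subst_l a N M2)
  | Mu M => Mu (mu_subst_l (S a) (shift_mu N) M)
  | Name b U =>
      let U' := mu_subst_l a N U in
      Name b (if Nat.eqb b a then App N U' else U')
  end.

(** In the mu-rules [N] moves under the binder [Mu], hence the [shift_mu]. *)
Inductive red : term -> term -> Prop :=
| red_beta M N : red (App (Lam M) N) (subst0 N M)
| red_mu M N : red (App (Mu M) N) (Mu (mu_subst_r 0 (shift_mu N) M))
| red_mu' M N : red (App N (Mu M)) (Mu (mu_subst_l 0 (shift_mu N) M))
| red_Lam M M' : red M M' -> red (Lam M) (Lam M')
| red_AppL M M' N : red M M' -> red (App M N) (App M' N)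
| red_AppR M N N' : red N N' -> red (App M N) (App M N')
| red_Mu M M' : red M M' -> red (Mu M) (Mu M')
| red_Name a M M' : red M M' -> red (Name a M) (Name a M').

Definition strongly_normalizing (M : term) : Prop :=
  ~ exists f : nat -> term, f 0 = M /\ forall n, red (f n) (f (S n)).

Inductive ty (atom : Type) : Type :=
| Atom (p : atom)
| Bot
| Arr (A B : ty atom).

Arguments Bot {atom}.

(** A context is split in two lists indexed by de Bruijn indices: entry [x] of
    [G] is the [A] such that [x : A], and entry [a] of [D] is the [A] such that
    [a : ~A] (mu-variables only ever have negated types, so the negation is
    left implicit). *)
Inductive typing (atom : Type) :
  list (ty atom) -> list (ty atom) -> term -> ty atom -> Prop :=
| T_Var G D x A : nth_error G x = Some A -> typing G D (Var x) A
| T_Lam G D M A B : typing (A :: G) D M B -> typing G D (Lam M) (Arr A B)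
| T_App G D M N A B :
    typing G D M (Arr A B) -> typing G D N A -> typing G D (App M N) B
| T_Mu G D M A : typing G (A :: D) M Bot -> typing G D (Mu M) A
| T_Name G D a M A :
    nth_error D a = Some A -> typing G D M A -> typing G D (Name a M) Bot.

Definition typed (atom : Type) (M : term) : Prop :=
  exists (G D : list (ty atom)) (A : ty atom), typing G D M A.

(* Main.v *)
(** Symmetric reducibility candidates (Barbanera-Berardi), with stacks of
    applicative frames in the role of co-terms: a mu-variable of type [~A] may be
    replaced by any stack accepting [A].  Whether a term is a value of type [A]
    depends on the stacks of [A] when it reduces to some [Mu P], and whether
    [(M _) :: E] is a stack of [A] depends on the values of [A] when [M] reduces to
    some [Lam P] or [Mu P].  Both dependencies are antitone, so their composite is
    monotone and Knaster-Tarski gives values and stacks solving the two conditions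
    simultaneously.  Since only the head forms of a term are tested, an application
    is a value as soon as the head forms of its two sides behave, and the critical
    pair between mu and mu' needs no separate argument. *)

From Stdlib Require Import Arith List Relations FunctionalExtensionality.
Require Import Defs.
Import ListNotations.

(** * Stacks of frames and parallel substitution *)

(** [FArg N] is the frame [(_ N)] and [FFun M] is the frame [(M _)]. *)
Inductive frame : Type :=
| FArg (N : term)
| FFun (M : term).

Notation stack := (list frame).

Definition plug (f : frame) (U : term) : term :=
  match f with FArg N => App U N | FFun M => App M U end.

(** The head of the list is the innermost frame. *)
Fixpoint fill (E : stack) (U : term) : term :=
  match E with [] => U | f :: E => fill E (plug f U) end.

Definition map_frame (g : term -> term) (f : frame) : frame :=
  match f with FArg N => FArg (g N) | FFun M => FFun (g M) end.

Definition ren_stack (rl rm : nat -> nat) : stack -> stack :=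
  map (map_frame (rename rl rm)).

Definition ren_entry (rl rm : nat -> nat) (p : nat * stack) : nat * stack :=
  (rm (fst p), ren_stack rl rm (snd p)).

Definition up_lam (s : nat -> term) : nat -> term :=
  scons (Var 0) (fun n => shift_lam (s n)).

Definition econs (p : nat * stack) (e : nat -> nat * stack) (a : nat) : nat * stack :=
  match a with 0 => p | S b => e b end.

Definition up_mu (e : nat -> nat * stack) : nat -> nat * stack :=
  econs (0, []) (fun a => ren_entry (fun x => x) S (e a)).

(** [e a = (b, E)] means that [(a U)] becomes [(b E[U])].  Renaming, [subst],
    [mu_subst_r] and [mu_subst_l] are all instances. *)
Fixpoint psubst (s : nat -> term) (e : nat -> nat * stack) (M : term) : term :=
  match M with
  | Var x => s x
  | Lam M => Lam (psubst (up_lam s) (fun a => ren_entry S (fun b => b) (e a)) M)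
  | App M N => App (psubst s e M) (psubst s e N)
  | Mu M => Mu (psubst (fun n => shift_mu (s n)) (up_mu e) M)
  | Name a M => Name (fst (e a)) (fill (snd (e a)) (psubst s e M))
  end.

Definition psubst_stack (s : nat -> term) (e : nat -> nat * stack) : stack -> stack :=
  map (map_frame (psubst s e)).

(** Composition of entries: if [e b = (c, F)], then [(b E[U])] is sent to [(c F[E'[U']])]. The
    frames of the first substitution stay innermost, hence first in the list. *)
Definition psubst_entry (s : nat -> term) (e : nat -> nat * stack) (p : nat * stack)
  : nat * stack :=
  (fst (e (fst p)), psubst_stack s e (snd p) ++ snd (e (fst p))).

Definition eid (a : nat) : nat * stack := (a, []).

(** * Equations of parallel substitution *)

Lemma fill_app E F U : fill (E ++ F) U = fill F (fill E U).
Proof. revert U; induction E as [|f E IH]; simpl; auto. Qed.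

Lemma ren_stack_app rl rm E F :
  ren_stack rl rm (E ++ F) = ren_stack rl rm E ++ ren_stack rl rm F.
Proof. apply map_app. Qed.

Lemma map_map_frame g h k E :
  (forall M, g (h M) = k M) ->
  map (map_frame g) (map (map_frame h) E) = map (map_frame k) E.
Proof.
  intros H; rewrite map_map; apply map_ext; intros [N|N]; simpl; now rewrite H.
Qed.

Lemma map_frame_id g E : (forall M, g M = M) -> map (map_frame g) E = E.
Proof.
  intros H; rewrite <- (map_id E) at 2; apply map_ext; intros [N|N]; simpl; now rewrite H.
Qed.

Lemma rename_fill rl rm E U :
  rename rl rm (fill E U) = fill (ren_stack rl rm E) (rename rl rm U).
Proof.
  revert U; induction E as [|[N|N] E IH]; intros U; simpl; auto; now rewrite IH.
Qed.

Lemma psubst_fill s e E U :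
  psubst s e (fill E U) = fill (psubst_stack s e E) (psubst s e U).
Proof.
  revert U; induction E as [|[N|N] E IH]; intros U; simpl; auto; now rewrite IH.
Qed.

Lemma up_ren_comp r2 r1 :
  (fun n => up_ren r2 (up_ren r1 n)) = up_ren (fun n => r2 (r1 n)).
Proof. apply functional_extensionality; intros [|n]; reflexivity. Qed.

Lemma rename_rename M : forall rl2 rm2 rl1 rm1,
  rename rl2 rm2 (rename rl1 rm1 M)
  = rename (fun n => rl2 (rl1 n)) (fun a => rm2 (rm1 a)) M.
Proof.
  induction M as [x|M IH|M IHM N IHN|M IH|a M IH]; intros; simpl; f_equal; auto.
  - now rewrite IH, up_ren_comp.
  - now rewrite IH, up_ren_comp.
Qed.

Lemma ren_stack_ren_stack rl2 rm2 rl1 rm1 E :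
  ren_stack rl2 rm2 (ren_stack rl1 rm1 E)
  = ren_stack (fun n => rl2 (rl1 n)) (fun a => rm2 (rm1 a)) E.
Proof. apply map_map_frame; intros M; apply rename_rename. Qed.

Lemma ren_entry_ren_entry rl2 rm2 rl1 rm1 p :
  ren_entry rl2 rm2 (ren_entry rl1 rm1 p)
  = ren_entry (fun n => rl2 (rl1 n)) (fun a => rm2 (rm1 a)) p.
Proof. unfold ren_entry; simpl; now rewrite ren_stack_ren_stack. Qed.

Lemma psubst_rename M : forall s e rl rm,
  psubst s e (rename rl rm M) = psubst (fun n => s (rl n)) (fun a => e (rm a)) M.
Proof.
  induction M as [x|M IH|M IHM N IHN|M IH|a M IH]; intros; simpl; f_equal; auto.
  - rewrite IH; f_equal; apply functional_extensionality; intros [|n]; reflexivity.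
  - rewrite IH; f_equal; apply functional_extensionality; intros [|n]; reflexivity.
  - now rewrite IH.
Qed.

Lemma rename_psubst M : forall s e rl rm,
  rename rl rm (psubst s e M)
  = psubst (fun n => rename rl rm (s n)) (fun a => ren_entry rl rm (e a)) M.
Proof.
  induction M as [x|M IH|M IHM N IHN|M IH|a M IH]; intros; simpl; f_equal; auto.
  - rewrite IH; f_equal; apply functional_extensionality.
    + intros [|n]; simpl; auto; unfold shift_lam; now rewrite !rename_rename.
    + intros a; now rewrite !ren_entry_ren_entry.
  - rewrite IH; f_equal; apply functional_extensionality.
    + intros n; unfold shift_mu; now rewrite !rename_rename.
    + intros [|a]; simpl; auto; now rewrite !ren_entry_ren_entry.
  - now rewrite rename_fill, IH.
Qed.

Lemma psubst_stack_ren s e rl rm E :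
  psubst_stack s e (ren_stack rl rm E)
  = psubst_stack (fun n => s (rl n)) (fun a => e (rm a)) E.
Proof. apply map_map_frame; intros M; apply psubst_rename. Qed.

Lemma ren_stack_psubst s e rl rm E :
  ren_stack rl rm (psubst_stack s e E)
  = psubst_stack (fun n => rename rl rm (s n)) (fun a => ren_entry rl rm (e a)) E.
Proof. apply map_map_frame; intros M; apply rename_psubst. Qed.

Lemma psubst_entry_ren s2 e2 rl rm s e p :
  (forall n, s2 (rl n) = rename rl rm (s n)) ->
  (forall a, e2 (rm a) = ren_entry rl rm (e a)) ->
  psubst_entry s2 e2 (ren_entry rl rm p) = ren_entry rl rm (psubst_entry s e p).
Proof.
  intros Hs He; unfold psubst_entry; simpl; unfold ren_entry; simpl.
  rewrite He, psubst_stack_ren; simpl; f_equal.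
  rewrite ren_stack_app, ren_stack_psubst.
  f_equal.
  f_equal; apply functional_extensionality; auto.
Qed.

Lemma psubst_psubst M : forall s2 e2 s1 e1,
  psubst s2 e2 (psubst s1 e1 M)
  = psubst (fun n => psubst s2 e2 (s1 n)) (fun a => psubst_entry s2 e2 (e1 a)) M.
Proof.
  induction M as [x|M IH|M IHM N IHN|M IH|a M IH]; intros; simpl; f_equal; auto.
  - rewrite IH; f_equal; apply functional_extensionality.
    + intros [|n]; simpl; auto; unfold shift_lam.
      now rewrite psubst_rename, rename_psubst.
    + intros a; now apply psubst_entry_ren.
  - rewrite IH; f_equal; apply functional_extensionality.
    + intros n; unfold shift_mu; now rewrite psubst_rename, rename_psubst.
    + intros [|a]; simpl; auto; now apply psubst_entry_ren.
  - now rewrite psubst_fill, IH, fill_app.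
Qed.

(** * Renaming and the substitutions of the calculus as instances of [psubst] *)

Lemma up_lam_var rl : up_lam (fun n => Var (rl n)) = fun n => Var (up_ren rl n).
Proof. apply functional_extensionality; intros [|n]; reflexivity. Qed.

Lemma up_mu_ren rm :
  up_mu (fun a => (rm a, [])) = fun a => (up_ren rm a, []).
Proof. apply functional_extensionality; intros [|n]; reflexivity. Qed.

Lemma rename_as_psubst M : forall rl rm,
  rename rl rm M = psubst (fun n => Var (rl n)) (fun a => (rm a, [])) M.
Proof.
  induction M as [x|M IH|M IHM N IHN|M IH|a M IH]; intros; simpl; f_equal; auto.
  - now rewrite up_lam_var, IH.
  - now rewrite up_mu_ren, IH.
Qed.

Lemma rename_id M : rename (fun n => n) (fun a => a) M = M.
Proof.
  assert (H : up_ren (fun n => n) = fun n => n)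
    by (apply functional_extensionality; intros [|n]; reflexivity).
  induction M; simpl; rewrite ?H; congruence.
Qed.

Lemma psubst_id M : psubst Var eid M = M.
Proof.
  rewrite <- (rename_id M) at 2; now rewrite rename_as_psubst.
Qed.

Lemma psubst_stack_id E : psubst_stack Var eid E = E.
Proof. apply map_frame_id, psubst_id. Qed.

Lemma subst_as_psubst M : forall s, subst s M = psubst s eid M.
Proof.
  induction M as [x|M IH|M IHM N IHN|M IH|a M IH]; intros; simpl; f_equal; auto.
  rewrite IH; f_equal; apply functional_extensionality; now intros [|a].
Qed.

(** The common form of [mu_subst_r] and [mu_subst_l], which differ only in the kind of the single
    frame in [E]. *)
Definition at_mu (a : nat) (E : stack) (b : nat) : nat * stack :=
  (b, if Nat.eqb b a then E else []).

Lemma up_at_mu a E : up_mu (at_mu a E) = at_mu (S a) (ren_stack (fun x => x) S E).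
Proof.
  apply functional_extensionality; intros [|b]; simpl; auto.
  unfold ren_entry, at_mu; simpl; now destruct (Nat.eqb b a).
Qed.

Lemma ren_at_mu a E :
  (fun b => ren_entry S (fun c => c) (at_mu a E b))
  = at_mu a (ren_stack S (fun c => c) E).
Proof.
  apply functional_extensionality; intros b.
  unfold ren_entry, at_mu; simpl; now destruct (Nat.eqb b a).
Qed.

Lemma mu_subst_r_as_psubst M : forall a N,
  mu_subst_r a N M = psubst Var (at_mu a [FArg N]) M.
Proof.
  induction M as [x|M IH|M IHM N' IHN|M IH|b M IH]; intros; simpl; f_equal; auto.
  - rewrite IH, ren_at_mu; simpl; f_equal.
    apply functional_extensionality; now intros [|n].
  - now rewrite IH, up_at_mu.
  - rewrite IH; now destruct (Nat.eqb b a).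
Qed.

Lemma mu_subst_l_as_psubst M : forall a N,
  mu_subst_l a N M = psubst Var (at_mu a [FFun N]) M.
Proof.
  induction M as [x|M IH|M IHM N' IHN|M IH|b M IH]; intros; simpl; f_equal; auto.
  - rewrite IH, ren_at_mu; simpl; f_equal.
    apply functional_extensionality; now intros [|n].
  - now rewrite IH, up_at_mu.
  - rewrite IH; now destruct (Nat.eqb b a).
Qed.

(** * Absorption of stacks and fusion of substitutions *)

(** The body of [E[Mu M]] once all frames of [E] have been absorbed by [Mu]. *)
Definition mu_plug (E : stack) (M : term) : term :=
  psubst Var (econs (0, ren_stack (fun x => x) S E) (fun a => eid (S a))) M.

Lemma at_mu_0 E : at_mu 0 E = econs (0, E) (fun a => eid (S a)).
Proof. apply functional_extensionality; intros [|a]; reflexivity. Qed.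

Lemma mu_subst_r_plug N M : mu_subst_r 0 (shift_mu N) M = mu_plug [FArg N] M.
Proof. now rewrite mu_subst_r_as_psubst, at_mu_0. Qed.

Lemma mu_subst_l_plug N M : mu_subst_l 0 (shift_mu N) M = mu_plug [FFun N] M.
Proof. now rewrite mu_subst_l_as_psubst, at_mu_0. Qed.

Lemma mu_plug_nil M : mu_plug [] M = M.
Proof.
  unfold mu_plug; simpl; rewrite <- (psubst_id M) at 2; f_equal.
  apply functional_extensionality; intros [|a]; reflexivity.
Qed.

(** After lifting, index 0 occurs in no image except that of the bound name itself, so attaching [E]
    to it only changes entry 0. *)
Lemma mu_plug_psubst E s e M :
  mu_plug E (psubst (fun n => shift_mu (s n)) (up_mu e) M)
  = psubst (fun n => shift_mu (s n))
      (econs (0, ren_stack (fun x => x) S E)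
             (fun a => ren_entry (fun x => x) S (e a))) M.
Proof.
  unfold mu_plug; rewrite psubst_psubst; f_equal; apply functional_extensionality.
  - intros n; unfold shift_mu; rewrite psubst_rename; symmetry; apply rename_as_psubst.
  - intros [|a]; simpl; auto.
    unfold psubst_entry, ren_entry; simpl; rewrite app_nil_r; f_equal.
    rewrite psubst_stack_ren; apply map_ext; intros [N|N]; simpl; f_equal;
      symmetry; apply rename_as_psubst.
Qed.

(** The first pass keeps the name 0 and, since [E] is shifted, puts no further name 0 inside its
    frames. The second pass therefore only lengthens each stack. *)
Lemma mu_plug_app E F M : mu_plug F (mu_plug E M) = mu_plug (E ++ F) M.
Proof.
  unfold mu_plug; rewrite psubst_psubst; f_equal.
  apply functional_extensionality; intros [|a]; simpl; auto.
  unfold psubst_entry; simpl; f_equal.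
  rewrite ren_stack_app; f_equal.
  rewrite psubst_stack_ren; apply map_ext; intros [N|N]; simpl; f_equal;
    symmetry; apply rename_as_psubst.
Qed.

Lemma psubst_mu_plug s e E M :
  psubst (fun n => shift_mu (s n)) (up_mu e) (mu_plug E M)
  = mu_plug (psubst_stack s e E) (psubst (fun n => shift_mu (s n)) (up_mu e) M).
Proof.
  rewrite mu_plug_psubst; unfold mu_plug; rewrite psubst_psubst; f_equal.
  apply functional_extensionality; intros [|a]; simpl.
  - unfold psubst_entry; simpl; rewrite app_nil_r; f_equal.
    rewrite psubst_stack_ren, ren_stack_psubst; reflexivity.
  - reflexivity.
Qed.

Lemma subst0_psubst N s e M :
  subst0 N (psubst (up_lam s) (fun a => ren_entry S (fun b => b) (e a)) M)
  = psubst (scons N s) e M.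
Proof.
  unfold subst0; rewrite subst_as_psubst, psubst_psubst; f_equal;
    apply functional_extensionality.
  - intros [|n]; simpl; auto; unfold shift_lam; rewrite psubst_rename; apply psubst_id.
  - intros a; unfold psubst_entry; simpl; rewrite app_nil_r, psubst_stack_ren.
    simpl; rewrite psubst_stack_id; now destruct (e a).
Qed.

Lemma psubst_subst0 s e N M :
  psubst s e (subst0 N M)
  = subst0 (psubst s e N)
      (psubst (up_lam s) (fun a => ren_entry S (fun b => b) (e a)) M).
Proof.
  rewrite subst0_psubst; unfold subst0; rewrite subst_as_psubst, psubst_psubst; f_equal;
    apply functional_extensionality.
  - now intros [|n].
  - intros a; unfold psubst_entry; simpl; now destruct (e a).
Qed.

(** [val] tests renamed abstractions, so contracta appear with a renamed body. Fusing everything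
    into one [psubst] gives the shape to which the induction hypothesis of [adequacy] applies;
    [mu_plug_rename_psubst] does the same for [Mu]. *)
Lemma subst0_rename_psubst N rl rm s e M :
  subst0 N (rename (up_ren rl) rm
    (psubst (up_lam s) (fun a => ren_entry S (fun b => b) (e a)) M))
  = psubst (scons N (fun n => rename rl rm (s n))) (fun a => ren_entry rl rm (e a)) M.
Proof.
  rewrite rename_psubst, <- subst0_psubst; do 2 f_equal; apply functional_extensionality.
  - intros [|n]; simpl; auto; unfold shift_lam; now rewrite !rename_rename.
  - intros a; now rewrite !ren_entry_ren_entry.
Qed.

Lemma mu_plug_rename_psubst E rl rm s e M :
  mu_plug E (rename rl (up_ren rm) (psubst (fun n => shift_mu (s n)) (up_mu e) M))
  = psubst (fun n => shift_mu (rename rl rm (s n)))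
      (econs (0, ren_stack (fun x => x) S E)
             (fun a => ren_entry (fun x => x) S (ren_entry rl rm (e a)))) M.
Proof.
  rewrite rename_psubst, <- mu_plug_psubst; do 2 f_equal; apply functional_extensionality.
  - intros n; unfold shift_mu; now rewrite !rename_rename.
  - intros [|a]; simpl; auto; now rewrite !ren_entry_ren_entry.
Qed.

(** * Reduction sequences under substitution *)

Notation steps := (clos_refl_trans_1n term red).

Notation SN := (Acc (fun N M => red M N)).

Lemma steps_trans M N P : steps M N -> steps N P -> steps M P.
Proof.
  induction 1 as [|M M1 N HM _ IH]; intros H; auto.
  econstructor; [exact HM | auto].
Qed.

Lemma steps_one M N : red M N -> steps M N.
Proof. intros H; econstructor; [exact H | constructor]. Qed.

Lemma steps_map (g : term -> term) M N :
  (forall P Q, red P Q -> red (g P) (g Q)) -> steps M N -> steps (g M) (g N).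
Proof.
  intros Hg; induction 1; [constructor | econstructor; eauto].
Qed.

Lemma steps_App M M' N N' : steps M M' -> steps N N' -> steps (App M N) (App M' N').
Proof.
  intros HM HN; apply steps_trans with (App M' N).
  - apply (steps_map (fun P => App P N)); auto; intros; now constructor.
  - apply (steps_map (fun P => App M' P)); auto; intros; now constructor.
Qed.

Lemma SN_steps M N : SN M -> steps M N -> SN N.
Proof.
  intros HM; induction 1; auto; apply IHclos_refl_trans_1n; now apply HM.
Qed.

Lemma fill_red E : forall M N, red M N -> red (fill E M) (fill E N).
Proof.
  induction E as [|[P|P] E IH]; simpl; auto; intros; apply IH; now constructor.
Qed.

(** Each of the three contracta commutes with parallel substitution, and the redex stays in place,
    possibly under more frames; hence a single step suffices. *)
Lemma psubst_red M N : red M N -> forall s e, red (psubst s e M) (psubst s e N).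
Proof.
  induction 1; intros s e; simpl; try (constructor; auto; fail).
  - rewrite psubst_subst0; apply red_beta.
  - rewrite mu_subst_r_plug, psubst_mu_plug; simpl; rewrite <- mu_subst_r_plug.
    apply red_mu.
  - rewrite mu_subst_l_plug, psubst_mu_plug; simpl; rewrite <- mu_subst_l_plug.
    apply red_mu'.
  - constructor; now apply fill_red.
Qed.

Lemma psubst_steps M N s e : steps M N -> steps (psubst s e M) (psubst s e N).
Proof. apply (steps_map (psubst s e)); intros; now apply psubst_red. Qed.

Lemma rename_steps M N rl rm : steps M N -> steps (rename rl rm M) (rename rl rm N).
Proof. rewrite !rename_as_psubst; apply psubst_steps. Qed.

Definition frame_steps (f g : frame) : Prop :=
  match f, g with
  | FArg M, FArg N | FFun M, FFun N => steps M N
  | _, _ => False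
  end.

Definition entry_steps (p q : nat * stack) : Prop :=
  fst p = fst q /\ Forall2 frame_steps (snd p) (snd q).

Lemma fill_steps E F : Forall2 frame_steps E F ->
  forall M N, steps M N -> steps (fill E M) (fill F N).
Proof.
  induction 1 as [|[P|P] [Q|Q] E F Hf _ IH]; simpl; intros; try easy; apply IH;
    now apply steps_App.
Qed.

Lemma ren_entry_steps rl rm p q :
  entry_steps p q -> entry_steps (ren_entry rl rm p) (ren_entry rl rm q).
Proof.
  destruct p as [b E], q as [c F]; intros [H1 H2]; simpl in *; subst c.
  split; auto; simpl; induction H2 as [|[P|P] [Q|Q] E F Hf _ IH]; simpl; try easy;
    constructor; auto; now apply rename_steps.
Qed.

Lemma psubst_steps_pointwise M : forall s s' e e',
  (forall n, steps (s n) (s' n)) -> (forall a, entry_steps (e a) (e' a)) ->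
  steps (psubst s e M) (psubst s' e' M).
Proof.
  induction M as [x|M IH|M IHM N IHN|M IH|a M IH]; intros s s' e e' Hs He; simpl; auto.
  - apply steps_map; [intros; now constructor|]; apply IH.
    + intros [|n]; simpl; [constructor | now apply rename_steps].
    + intros a; now apply ren_entry_steps.
  - apply steps_App; auto.
  - apply steps_map; [intros; now constructor|]; apply IH.
    + intros n; now apply rename_steps.
    + intros [|a]; simpl; [split; auto; constructor | now apply ren_entry_steps].
  - destruct (He a) as [-> Hf].
    apply steps_map; [intros; now constructor|]; apply fill_steps; auto.
Qed.

Lemma subst0_steps N N' M : steps N N' -> steps (subst0 N M) (subst0 N' M).
Proof.
  intros H; unfold subst0; rewrite !subst_as_psubst; apply psubst_steps_pointwise.
  - intros [|n]; simpl; [auto | constructor].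
  - intros a; split; constructor.
Qed.

Lemma mu_plug_steps_frame f g M :
  frame_steps f g -> steps (mu_plug [f] M) (mu_plug [g] M).
Proof.
  intros H; apply psubst_steps_pointwise.
  - constructor.
  - intros [|a]; simpl; [|split; constructor].
    split; auto; repeat constructor.
    destruct f, g; simpl in *; try easy; now apply rename_steps.
Qed.

Lemma mu_plug_steps E M N : steps M N -> steps (mu_plug E M) (mu_plug E N).
Proof. apply psubst_steps. Qed.

Lemma subst0_steps_body N M M' : steps M M' -> steps (subst0 N M) (subst0 N M').
Proof. unfold subst0; rewrite !subst_as_psubst; apply psubst_steps. Qed.

(** * Head forms reached by reduction *)

Lemma steps_Lam_inv M N : steps (Lam M) N -> exists P, N = Lam P /\ steps M P.
Proof.
  intros H; remember (Lam M) as L eqn:E; revert M E.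
  induction H as [|L L1 N Hr _ IH]; intros M ->.
  - exists M; split; auto; constructor.
  - inversion Hr; subst; destruct (IH _ eq_refl) as (P & -> & HP).
    exists P; split; auto; econstructor; eauto.
Qed.

Lemma steps_Mu_inv M N : steps (Mu M) N -> exists P, N = Mu P /\ steps M P.
Proof.
  intros H; remember (Mu M) as L eqn:E; revert M E.
  induction H as [|L L1 N Hr _ IH]; intros M ->.
  - exists M; split; auto; constructor.
  - inversion Hr; subst; destruct (IH _ eq_refl) as (P & -> & HP).
    exists P; split; auto; econstructor; eauto.
Qed.

Lemma steps_Name_inv a M N : steps (Name a M) N -> exists P, N = Name a P.
Proof.
  intros H; remember (Name a M) as L eqn:E; revert M E.
  induction H as [|L L1 N Hr _ IH]; intros M ->; eauto.
  inversion Hr; subst; eauto.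
Qed.

Lemma steps_Var_inv x N : steps (Var x) N -> N = Var x.
Proof. inversion 1 as [|? ? Hr]; subst; auto; inversion Hr. Qed.

(** Steps before the first contraction at the root are reorganized: those in the side providing the
    head form are kept, those in the other side are postponed into the contractum, which can then
    mention the original [N] or [M]. *)
Lemma steps_App_inv M N R : steps (App M N) R ->
  (exists M' N', R = App M' N') \/
  (exists P, steps M (Lam P) /\ steps (subst0 N P) R) \/
  (exists P, steps M (Mu P) /\ steps (Mu (mu_plug [FArg N] P)) R) \/
  (exists P, steps N (Mu P) /\ steps (Mu (mu_plug [FFun M] P)) R).
Proof.
  intros H; remember (App M N) as L eqn:E; revert M N E.
  induction H as [|L L1 R Hr HR IH]; intros M N ->; eauto.
  inversion Hr as [P Q|P Q|P Q| |M0 M1 N0 HM|M0 N0 N1 HN| |]; subst.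
  - right; left; exists P; split; [constructor | auto].
  - right; right; left; exists P; rewrite <- mu_subst_r_plug; split; [constructor | auto].
  - right; right; right; exists P; rewrite <- mu_subst_l_plug; split; [constructor | auto].
  - destruct (IH _ _ eq_refl) as [?|[(P & H1 & H2)|[(P & H1 & H2)|(P & H1 & H2)]]]; auto.
    + right; left; exists P; split; auto; econstructor; eauto.
    + right; right; left; exists P; split; auto; econstructor; eauto.
    + right; right; right; exists P; split; auto.
      eapply steps_trans; [|exact H2]; apply steps_map; [intros; now constructor|].
      apply mu_plug_steps_frame; now apply steps_one.
  - destruct (IH _ _ eq_refl) as [?|[(P & H1 & H2)|[(P & H1 & H2)|(P & H1 & H2)]]]; auto.
    + right; left; exists P; split; auto.
      eapply steps_trans; [|exact H2]; apply subst0_steps; now apply steps_one.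
    + right; right; left; exists P; split; auto.
      eapply steps_trans; [|exact H2]; apply steps_map; [intros; now constructor|].
      apply mu_plug_steps_frame; now apply steps_one.
    + right; right; right; exists P; split; auto; econstructor; eauto.
Qed.

(** * Closure properties of strong normalization *)

Lemma SN_Lam M : SN M -> SN (Lam M).
Proof.
  induction 1 as [M _ IH]; constructor; intros N H; inversion H; subst; auto.
Qed.

Lemma SN_Mu M : SN M -> SN (Mu M).
Proof.
  induction 1 as [M _ IH]; constructor; intros N H; inversion H; subst; auto.
Qed.

Lemma SN_Name a M : SN M -> SN (Name a M).
Proof.
  induction 1 as [M _ IH]; constructor; intros N H; inversion H; subst; auto.
Qed.

(** Nested induction on the accessibility of [M] and [N]. The hypotheses range over all reducts of
    the side with the head form, so they survive steps there; a step in the other side replaces each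
    tested contractum by a reduct of it. *)
Lemma SN_App M N : SN M -> SN N ->
  (forall P, steps M (Lam P) -> SN (subst0 N P)) ->
  (forall P, steps M (Mu P) -> SN (mu_plug [FArg N] P)) ->
  (forall P, steps N (Mu P) -> SN (mu_plug [FFun M] P)) ->
  SN (App M N).
Proof.
  intros HM; revert N; induction HM as [M HM IHM]; intros N HN.
  induction HN as [N HN IHN]; intros H1 H2 H3; constructor; intros R HR.
  inversion HR as [P Q|P Q|P Q| |M0 M1 N0 Hr|M0 N0 N1 Hr| |]; subst.
  - apply H1; constructor.
  - rewrite mu_subst_r_plug; apply SN_Mu, H2; constructor.
  - rewrite mu_subst_l_plug; apply SN_Mu, H3; constructor.
  - apply IHM; auto.
    + now constructor.
    + intros P HP; apply H1; econstructor; eauto.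
    + intros P HP; apply H2; econstructor; eauto.
    + intros P HP; apply SN_steps with (mu_plug [FFun M] P); auto.
      apply mu_plug_steps_frame; now apply steps_one.
  - apply IHN; auto.
    + intros P HP; apply SN_steps with (subst0 N P); auto.
      apply subst0_steps; now apply steps_one.
    + intros P HP; apply SN_steps with (mu_plug [FArg N] P); auto.
      apply mu_plug_steps_frame; now apply steps_one.
    + intros P HP; apply H3; econstructor; eauto.
Qed.

(** * Candidates and their fixed point *)

Record cand : Type := Cand {
  bodies : term -> Prop;
  stacks : stack -> Prop
}.

(** Only the head forms reachable by reduction are tested, and they are tested
    after an arbitrary renaming, so that candidates are closed under renaming
    by construction. *)
Definition val (K : cand) (V : term) : Prop :=
  forall rl rm, let V' := rename rl rm V in
  SN V' /\
  (forall P, steps V' (Lam P) -> bodies K P) /\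
  (forall P, steps V' (Mu P) -> forall E, stacks K E -> SN (mu_plug E P)).

Record good (K : cand) : Prop := {
  good_nil : stacks K [];
  good_ren : forall rl rm E, stacks K E -> stacks K (ren_stack rl rm E);
  good_fill : forall V E, val K V -> stacks K E -> SN (fill E V)
}.

(** [S] is a bare set of terms rather than a candidate because it gets instantiated by
    approximations of the fixed point. *)
Definition fun_into (S : term -> Prop) (K : cand) (M : term) : Prop :=
  forall rl rm, let M' := rename rl rm M in
  SN M' /\
  (forall P, steps M' (Lam P) -> forall U, S U -> val K (subst0 U P)) /\
  (forall P, steps M' (Mu P) ->
     forall U E, S U -> stacks K E -> SN (mu_plug (FArg U :: E) P)).

(** The target of the function [M] is an arbitrary good candidate: the type of
    [M] is larger than the one being interpreted, so a recursion on types cannot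
    refer to its interpretation. *)
Inductive stacks_over (base : stack -> Prop) (S : term -> Prop) : stack -> Prop :=
| so_nil : stacks_over base S []
| so_base E : base E -> stacks_over base S E
| so_fun M E K : good K -> fun_into S K M -> stacks K E ->
    stacks_over base S (FFun M :: E).

(** The intersection of all pre-fixed points, formed impredicatively. *)
Definition lfp (F : (term -> Prop) -> term -> Prop) (V : term) : Prop :=
  forall S : term -> Prop, (forall U, F S U -> S U) -> S V.

Definition sym_values (B : term -> Prop) (base : stack -> Prop) : term -> Prop :=
  lfp (fun S => val (Cand B (stacks_over base S))).

Definition sym_cand (B : term -> Prop) (base : stack -> Prop) : cand :=
  Cand B (stacks_over base (sym_values B base)).

Lemma val_antitone B Y Y' V :
  (forall E, Y E -> Y' E) -> val (Cand B Y') V -> val (Cand B Y) V.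
Proof.
  intros HY HV rl rm; destruct (HV rl rm) as (H1 & H2 & H3).
  split; [|split]; auto; intros; eapply H3; eauto; now apply HY.
Qed.

Lemma fun_into_antitone (S S' : term -> Prop) K M :
  (forall V, S V -> S' V) -> fun_into S' K M -> fun_into S K M.
Proof.
  intros HS HM rl rm; destruct (HM rl rm) as (H1 & H2 & H3).
  split; [|split]; auto.
Qed.

Lemma stacks_over_antitone base (S S' : term -> Prop) E :
  (forall V, S V -> S' V) -> stacks_over base S' E -> stacks_over base S E.
Proof.
  intros HS [|E' HE|M E' K HK HM HE]; [constructor | now constructor |].
  apply so_fun with K; auto; now apply fun_into_antitone with S'.
Qed.

(** The fixed point equation. Both [val] and [stacks_over] reverse inclusions, so the operator [F]
    is monotone and [lfp F] is a pre-fixed point; then so is [F (lfp F)], which gives the direction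
    from left to right. *)
Lemma sym_valuesP B base V : sym_values B base V <-> val (sym_cand B base) V.
Proof.
  set (F := fun S => val (Cand B (stacks_over base S))).
  assert (mono : forall S S' : term -> Prop,
             (forall U, S U -> S' U) -> forall U, F S U -> F S' U).
  { intros S S' HS U; apply val_antitone; intros E; now apply stacks_over_antitone. }
  assert (fold : forall U, F (lfp F) U -> lfp F U).
  { intros U HU S HS; apply HS; revert HU; apply mono; intros W HW; now apply HW. }
  split; [|apply fold].
  intros HV; apply (HV (F (lfp F))); intros U; now apply mono.
Qed.

(** * Closure properties of values *)

Lemma val_rename K V rl rm : val K V -> val K (rename rl rm V).
Proof. intros HV rl' rm'; rewrite rename_rename; apply HV. Qed.

Lemma val_steps K V V' : val K V -> steps V V' -> val K V'.
Proof.
  intros HV H rl rm; destruct (HV rl rm) as (H1 & H2 & H3).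
  apply rename_steps with (rl := rl) (rm := rm) in H; simpl; split; [|split].
  - eapply SN_steps; eauto.
  - intros P HP; apply H2; eapply steps_trans; eauto.
  - intros P HP; apply H3; eapply steps_trans; eauto.
Qed.

Lemma val_SN K V : val K V -> SN V.
Proof.
  intros HV; destruct (HV (fun x => x) (fun a => a)) as [H _]; now rewrite rename_id in H.
Qed.

Lemma val_Var K x : val K (Var x).
Proof.
  intros rl rm; simpl; split; [|split].
  - constructor; intros N H; inversion H.
  - intros P H; apply steps_Var_inv in H; discriminate.
  - intros P H; apply steps_Var_inv in H; discriminate.
Qed.

Lemma val_Name K a M : (forall rl rm, SN (rename rl rm M)) -> val K (Name a M).
Proof.
  intros HM rl rm; simpl; split; [|split].
  - now apply SN_Name.
  - intros P H; apply steps_Name_inv in H as [? ?]; discriminate.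
  - intros P H; apply steps_Name_inv in H as [? ?]; discriminate.
Qed.

Lemma fun_into_rename S K M rl rm : fun_into S K M -> fun_into S K (rename rl rm M).
Proof. intros HM rl' rm'; rewrite rename_rename; apply HM. Qed.

(* A reduct [Mu P] of [M U] arises from a head form of [M] or of [U]; plugging
   [E] into it amounts to plugging [(_ U) :: E] or [(M _) :: E] into that form. *)
Lemma val_App K KA M U :
  good K -> fun_into (val KA) K M -> val KA U ->
  (forall E M', fun_into (val KA) K M' -> stacks K E -> stacks KA (FFun M' :: E)) ->
  val K (App M U).
Proof.
  intros HK HM HU Hfun rl rm; simpl.
  assert (HM' := fun_into_rename _ _ _ rl rm HM).
  assert (HU' := val_rename _ _ rl rm HU).
  destruct (HM rl rm) as (M1 & M2 & M3); destruct (HU rl rm) as (U1 & U2 & U3).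
  revert HM' HU' M1 M2 M3 U1 U2 U3; generalize (rename rl rm M) (rename rl rm U).
  clear M U HM HU; intros M U HM HU M1 M2 M3 U1 U2 U3.
  pose proof (good_nil _ HK) as Hnil.
  assert (A1 : forall P, steps M (Lam P) -> val K (subst0 U P)) by eauto.
  assert (A2 : forall P E, steps M (Mu P) -> stacks K E ->
             SN (mu_plug E (mu_plug [FArg U] P))).
  { intros P E HP HE; rewrite mu_plug_app; simpl; eauto. }
  assert (A3 : forall P E, steps U (Mu P) -> stacks K E ->
             SN (mu_plug E (mu_plug [FFun M] P))).
  { intros P E HP HE; rewrite mu_plug_app; simpl; eauto. }
  split; [|split].
  (* With the empty stack, which [K] accepts, the two [Mu] clauses specialize to the single frames
     tested by [SN_App]. *)
  - apply SN_App; auto; intros P HP; eapply val_SN; eauto.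
  - intros P HP; apply steps_App_inv in HP as
      [(? & ? & ?)|[(Q & H1 & H2)|[(Q & H1 & H2)|(Q & H1 & H2)]]]; try discriminate.
    + destruct (A1 _ H1 (fun x => x) (fun a => a)) as (_ & H & _).
      rewrite rename_id in H; auto.
    + apply steps_Mu_inv in H2 as (? & ? & _); discriminate.
    + apply steps_Mu_inv in H2 as (? & ? & _); discriminate.
  - intros P HP E HE; apply steps_App_inv in HP as
      [(? & ? & ?)|[(Q & H1 & H2)|[(Q & H1 & H2)|(Q & H1 & H2)]]]; try discriminate.
    + destruct (A1 _ H1 (fun x => x) (fun a => a)) as (_ & _ & H).
      rewrite rename_id in H; auto.
    + apply steps_Mu_inv in H2 as (R & HR & H2); injection HR as <-.
      eapply SN_steps; [apply (A2 _ _ H1 HE) | now apply mu_plug_steps].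
    + apply steps_Mu_inv in H2 as (R & HR & H2); injection HR as <-.
      eapply SN_steps; [apply (A3 _ _ H1 HE) | now apply mu_plug_steps].
Qed.

(** A frame [FFun M] makes the value an argument of [M]. By [val_App] the application is a value of
    the target [K], and the goodness of [K] takes care of the remaining stack, so no induction on
    stacks occurs. *)
Lemma good_sym_cand B (base : stack -> Prop) :
  (forall rl rm E, base E -> base (ren_stack rl rm E)) ->
  (forall V E, val (sym_cand B base) V -> base E -> SN (fill E V)) ->
  good (sym_cand B base).
Proof.
  intros Hren Hfill; split.
  - constructor.
  - intros rl rm E [|E' HE|M E' K HK HM HE]; simpl.
    + constructor.
    + apply so_base; auto.
    + apply so_fun with K; auto; [now apply fun_into_rename | now apply good_ren].
  - intros V E HV HE; inversion HE as [|E' HE'|M E' K HK HM HE']; subst; simpl.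
    + eapply val_SN; eauto.
    + auto.
    + apply (good_fill _ HK); auto.
      apply val_App with (sym_cand B base); auto.
      * revert HM; apply fun_into_antitone; intros W; apply sym_valuesP.
      * intros E0 M0 H0 H1; apply so_fun with K; auto.
        revert H0; apply fun_into_antitone; intros W; apply sym_valuesP.
Qed.

(** * Interpretation of types and adequacy *)

(** At atoms and [Bot] no stack starts with an argument frame, so bodies of [Lam] are unconstrained
    there. Function frames are added by [sym_cand] at every type. *)
Fixpoint interp {atom : Type} (A : ty atom) : cand :=
  match A with
  | Atom _ | Bot => sym_cand (fun _ => True) (fun _ => False)
  | Arr A B =>
      sym_cand
        (fun P => forall N, val (interp A) N -> val (interp B) (subst0 N P))
        (fun E => exists N E', E = FArg N :: E' /\ val (interp A) N /\ stacks (interp B) E')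
  end.

Lemma interp_sym {atom : Type} (A : ty atom) : exists B base, interp A = sym_cand B base.
Proof. destruct A; simpl; eauto. Qed.

Lemma val_Arr_fun {atom : Type} (A B : ty atom) V :
  val (interp (Arr A B)) V -> fun_into (val (interp A)) (interp B) V.
Proof.
  intros HV rl rm; destruct (HV rl rm) as (H1 & H2 & H3); split; [|split]; auto.
  intros P HP U E HU HE; apply H3; auto; apply so_base; eauto.
Qed.

Lemma interp_fun_stack {atom : Type} (A : ty atom) K M E :
  good K -> fun_into (val (interp A)) K M -> stacks K E ->
  stacks (interp A) (FFun M :: E).
Proof.
  intros HK HM HE; destruct (interp_sym A) as (B & base & HA); rewrite HA in *.
  apply so_fun with K; auto; revert HM; apply fun_into_antitone; intros V; apply sym_valuesP.
Qed.

Lemma val_interp_App {atom : Type} (A B : ty atom) M N : good (interp B) ->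
  val (interp (Arr A B)) M -> val (interp A) N -> val (interp B) (App M N).
Proof.
  intros HB HM HN; apply val_App with (interp A); auto.
  - now apply val_Arr_fun.
  - intros; now apply interp_fun_stack with (interp B).
Qed.

(** [val_interp_App] asks for goodness of the result type only, so it is available at [Arr A B]
    before that type is known to be good. *)
Lemma good_interp {atom : Type} (A : ty atom) : good (interp A).
Proof.
  induction A as [p| |A IHA B IHB]; simpl; apply good_sym_cand; try tauto.
  - intros rl rm E (N & E' & -> & HN & HE).
    exists (rename rl rm N), (ren_stack rl rm E'); split; [reflexivity|split].
    + now apply val_rename.
    + now apply good_ren.
  - intros V E HV (N & E' & -> & HN & HE); simpl.
    apply (good_fill _ IHB); auto; now apply val_interp_App with A.
Qed.

(** Only the stacks of [e] are constrained; the target names are arbitrary, because a [Name] is a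
    value as soon as all renamings of its argument normalize. *)
Lemma adequacy {atom : Type} (G D : list (ty atom)) M A : typing G D M A -> forall s e,
  (forall x B, nth_error G x = Some B -> val (interp B) (s x)) ->
  (forall a B, nth_error D a = Some B -> stacks (interp B) (snd (e a))) ->
  val (interp A) (psubst s e M).
Proof.
  induction 1 as [G D x A Hx|G D M A B HM IH|G D M N A B HM IHM HN IHN
                 |G D M A HM IH|G D a M A Ha HM IH]; intros s e Hs He.
  - now apply Hs.
  (* Sending the new variable to itself gives normalization of the body; the clause for [Lam] uses a
     second instance, sending it to [N]. *)
  - assert (Hup : val (interp B)
      (psubst (up_lam s) (fun a => ren_entry S (fun b => b) (e a)) M)).
    { apply IH.
      - intros [|x] C HC; simpl in *; [apply val_Var | now apply val_rename, Hs].
      - intros a C HC; apply good_ren; [apply good_interp | now apply He]. }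
    intros rl rm; simpl psubst; simpl rename; simpl bodies; split; [|split].
    + now apply SN_Lam, Hup.
    + intros P HP N HN; apply steps_Lam_inv in HP as (Q & HQ & HP); injection HQ as <-.
      eapply val_steps; [|apply subst0_steps_body; exact HP].
      rewrite subst0_rename_psubst; apply IH.
      * intros [|x] C HC; simpl in *; [now injection HC as <- | now apply val_rename, Hs].
      * intros a C HC; apply good_ren; [apply good_interp | now apply He].
    + intros P HP; apply steps_Lam_inv in HP as (Q & HQ & HP); discriminate.
  - simpl; apply val_interp_App with A; auto; apply good_interp.
  (* The bound name receives any stack [E] of [A]: the empty one yields normalization, the general
     one the clause for [Mu]. *)
  - assert (Hup : forall rl rm E, stacks (interp A) E ->
      SN (mu_plug E (rename rl (up_ren rm)
            (psubst (fun n => shift_mu (s n)) (up_mu e) M)))).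
    { intros rl rm E HE; rewrite mu_plug_rename_psubst.
      apply val_SN with (interp (@Bot atom)), IH.
      - intros x C HC; now apply val_rename, val_rename, Hs.
      - intros [|a] C HC; simpl in *.
        + injection HC as <-; apply good_ren; auto; apply good_interp.
        + apply good_ren; [apply good_interp|].
          apply good_ren; [apply good_interp | now apply He]. }
    intros rl rm; simpl psubst; simpl rename; split; [|split].
    + apply SN_Mu; rewrite <- mu_plug_nil; apply Hup, good_nil, good_interp.
    + intros P HP; apply steps_Mu_inv in HP as (Q & HQ & HP); discriminate.
    + intros P HP E HE; apply steps_Mu_inv in HP as (Q & HQ & HP); injection HQ as <-.
      eapply SN_steps; [apply Hup, HE | apply mu_plug_steps, HP].
  - simpl psubst; apply val_Name; intros rl rm; rewrite rename_fill.
    apply (good_fill _ (good_interp A)).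
    + now apply val_rename, IH.
    + apply good_ren; [apply good_interp | now apply He].
Qed.

Lemma SN_no_infinite_reduction M : SN M -> strongly_normalizing M.
Proof.
  induction 1 as [M _ IH]; intros (f & <- & Hf).
  apply (IH (f 1) (Hf 0)); exists (fun n => f (S n)); auto.
Qed.

Theorem theorem4p19 (atom : Type) (M : term) :
  typed atom M -> strongly_normalizing M.
Proof.
  intros (G & D & A & HM); apply SN_no_infinite_reduction, val_SN with (interp A).
  (* The identity substitution qualifies: variables are values of every candidate, and empty stacks
     belong to every good one. *)
  rewrite <- psubst_id; apply adequacy with (1 := HM).
  - intros; apply val_Var.
  - intros; apply good_nil, good_interp.
Qed.
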